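(* Let $A$ be an algebraic information system and let $p$ be an approximable mapping from $A$ to $A$. Then the following conditions are equivalent: (1) $|p|:|A|\to|A|$ is a finitary projection. (2) For all $u,w\in\mathcal P_{\rm fin}(D_A)$, if $u\,p\,w$ then there is $v\in\mathcal P_{\rm fin}(D_A)$ such that $u\vdash_A v$, $v\,p\,v$ and $v\vdash_A w$.
   Context: For a set $D$, $\mathcal P_{\rm fin}(D)$ denotes the set of its finite subsets. An algebraic information system is a triple $A=(D_A,\nabla_A,\vdash_A)$ with $D_A$ a set, $\nabla_A\in D_A$, and $\vdash_A\subseteq \mathcal P_{\rm fin}(D_A)\times\mathcal P_{\rm fin}(D_A)$ such that for all finite sets: (1) $\emptyset\not\vdash_A\{\nabla_A\}$; (2) $v\subseteq u$ implies $u\vdash_A v$; (3) $u\vdash_A v_1,\dots,u\vdash_A v_n$ and $v_1\cup\dots\cup v_n\vdash_A w$ imply $u\vdash_A w$; (4) $\{\nabla_A\}\vdash_A u$. The domain $|A|$ is the set of all $x\subseteq D_A$ with $\nabla_A\notin x$ such that $u\subseteq x$ finite and $u\vdash_A v$ imply $v\subseteq x$; it is ordered by inclusion. An approximable mapping from $A$ to $A$ is a relation $p\subseteq\mathcal P_{\rm fin}(D_A)\times\mathcal P_{\rm fin}(D_A)$ such that: (1) $\emptyset\, p\,\emptyset$; (2) $u\not\vdash_A\{\nabla_A\}$ implies $\neg(u\,p\,\{\nabla_A\})$; (3) $\{\nabla_A\}\,p\,\{\nabla_A\}$; (4) $u\,p\,v_1,\dots,u\,p\,v_n$ imply $u\,p\,(v_1\cup\dots\cup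 v_n)$; (5) $u'\vdash_A u$, $u\,p\,v$, $v\vdash_A v'$ imply $u'\,p\,v'$. The associated (Scott continuous) function is $|p|(x)=\{d\in D_A\mid \exists u\subseteq x \text{ finite},\ u\,p\,\{d\}\}$. $|p|$ is a projection if $|p|\circ|p|=|p|$ and $|p|(x)\subseteq x$ for all $x\in|A|$. A projection is finitary if its set of fixed points, with the order of $|A|$, is algebraic, i.e. it is a directed complete partial order in which every element is the supremum of a directed set of compact elements (those below it). *)

(* Defs.v *)
From HB Require Import structures.
From mathcomp Require Import all_boot all_order finmap.
From mathcomp Require Import boolp classical_sets.

Set Implicit Arguments.
Unset Strict Implicit.
Unset Printing Implicit Defensive.

Import Order.TTheory.
Local Open Scope fset_scope.
Local Open Scope classical_set_scope.

Section SubPoset.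
Context {d : Order.disp_t} {T : porderType d}.

(* The elements of S, with the order of T restricted to S. *)
Definition subposet (S : set T) : Type := set_type S.

HB.instance Definition _ (S : set T) := SubChoice.on (subposet S).
HB.instance Definition _ (S : set T) :=
  Order.SubChoice_isSubPOrder.Build d T (mem S) d (subposet S).

End SubPoset.

Section AlgebraicPosets.
Context {d : Order.disp_t} (T : porderType d).
Implicit Types S : set T.

Definition directed S : Prop :=
  S !=set0 /\
  forall x y, S x -> S y -> exists z, [/\ S z, (x <= z)%O & (y <= z)%O].

Definition dcpo : Prop :=
  forall S, directed S -> exists s, isLub S s.

Definition compact_element (k : T) : Prop :=
  forall S s, directed S -> isLub S s -> (k <= s)%O ->
  exists2 x, S x & (k <= x)%O.

Definition compacts_below (x : T) : set T :=
  [set k | compact_element k /\ (k <= x)%O].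

Definition algebraic : Prop :=
  dcpo /\
  forall x, directed (compacts_below x) /\ isLub (compacts_below x) x.

End AlgebraicPosets.

Section Projections.
Context {d : Order.disp_t} {T : porderType d}.
Implicit Types f : T -> T.

Definition projection f : Prop :=
  f \o f = f /\ forall x, (f x <= x)%O.

(* Directedness, suprema and compactness of fixed points are taken inside this
   poset, not inside T. *)
Definition fixed_points f : porderType d := subposet [set x | f x = x].

Definition finitary_projection f : Prop :=
  projection f /\ algebraic (fixed_points f).

End Projections.

(* Finite families v_1, ..., v_n are sequences of finite sets (n = 0 included).
   Classically every type is a choiceType, so [token] is an arbitrary set. *)
Record algInfoSystem := AlgInfoSystem {
  token : choiceType;
  nabla : token;
  entails : {fset token} -> {fset token} -> Prop;
  entails_consistent : ~ entails fset0 [fset nabla];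
  entails_sub : forall u v, (v `<=` u)%fset -> entails u v;
  entails_trans : forall u w (vs : seq {fset token}),
    (forall v, v \in vs -> entails u v) ->
    entails (\bigcup_(v <- vs) v)%fset w -> entails u w;
  entails_nabla : forall u, entails [fset nabla] u
}.

Notation "u ⊢[ A ] v" := (@entails A u v) (at level 70, no associativity).

(* [[set` u]] is the finite set [u] seen as a subset. *)
Definition is_ideal (A : algInfoSystem) : set (set (token A)) :=
  [set x | ~ x (nabla A) /\
     forall u v : {fset token A},
       [set` u] `<=` x -> u ⊢[A] v -> [set` v] `<=` x].

(* The order is inclusion, inherited from [set (token A)] (see [subsetEset]). *)
Definition domain (A : algInfoSystem) : porderType set_display :=
  subposet (@is_ideal A).

Record approxMap (A : algInfoSystem) := ApproxMap {
  approx :> {fset token A} -> {fset token A} -> Prop;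
  approx0 : approx fset0 fset0;
  approx_consistent : forall u,
    ~ u ⊢[A] [fset nabla A] -> ~ approx u [fset nabla A];
  approx_nabla : approx [fset nabla A] [fset nabla A];
  approx_bigcup : forall u (vs : seq {fset token A}),
    (forall v, v \in vs -> approx u v) ->
    approx u (\bigcup_(v <- vs) v)%fset;
  approx_mono : forall u u' v v',
    u' ⊢[A] u -> approx u v -> v ⊢[A] v' -> approx u' v'
}.

Section AssociatedFunction.
Variables (A : algInfoSystem) (p : approxMap A).
Implicit Types (u v : {fset token A}) (x : set (token A)).

Definition approx_image x : set (token A) :=
  [set d | exists2 u, [set` u] `<=` x & p u [fset d]].

Lemma entails_refl u : u ⊢[A] u.
Proof. exact: entails_sub. Qed.

Lemma approx_union u v w : p u v -> p u w -> p u (v `|` w)%fset.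
Proof.
move=> uv uw; have := @approx_bigcup A p u [:: v; w].
rewrite !big_cons big_nil fsetU0; apply=> z.
by rewrite !inE => /orP[] /eqP ->.
Qed.

Lemma approx_image_fset x v :
  [set` v] `<=` approx_image x -> exists2 u, [set` u] `<=` x & p u v.
Proof.
elim/finSet_rect: v => v IH sv.
have [->|[d dv]] := fset_0Vmem v.
  by exists fset0; [move=> ? | exact: approx0].
have [u ux pu] := sv d dv.
have [|w wx pw] := IH (v `\ d)%fset (fproperD1 dv).
  by move=> e /=; rewrite !inE => /andP[_ ev]; exact: sv.
exists (u `|` w)%fset; first by rewrite set_fsetU; move=> e [/ux|/wx].
rewrite -(fsetD1K dv); apply: approx_union.
- exact: (approx_mono (entails_sub (fsubsetUl _ _)) pu (entails_refl _)).
- exact: (approx_mono (entails_sub (fsubsetUr _ _)) pw (entails_refl _)).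
Qed.

Lemma approx_image_ideal x : is_ideal x -> is_ideal (approx_image x).
Proof.
move=> [xN xC]; split.
  move=> [u ux pu]; apply: xN.
  have uN : u ⊢[A] [fset nabla A].
    by apply: contrapT => /(approx_consistent (a := p)).
  by apply: (xC _ _ ux uN); rewrite /= inE.
move=> v w /approx_image_fset[u ux pu] vw d /= dw; exists u => //.
apply: (approx_mono (entails_refl u) pu).
apply: (@entails_trans A v [fset d] [:: w]).
  by move=> z; rewrite inE => /eqP ->.
by rewrite big_seq1; apply: entails_sub; rewrite fsub1set.
Qed.

Definition approx_fun (x : domain A) : domain A :=
  SigSub (mem_set (approx_image_ideal (set_mem (valP x)))).

End AssociatedFunction.

(* Main.v *)
Require Import Defs.
From mathcomp Require Import all_boot all_order finmap.
From mathcomp Require Import boolp classical_sets.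

(* Write [cl u] for the least ideal containing a consistent finite set [u].
   Suprema of directed families of fixed points of [|p|] are unions, and the
   compact fixed points are exactly the ideals [cl v] with [v] consistent and
   [v p v]: a compact fixed point [k] is the directed union of the fixed points
   [|p|(cl v)], [v] a finite subset of [k], hence equals one of them, and then
   [v p v].  Condition (2) says that every fixed point is the union of the
   ideals [cl v] with [v p v] that it contains. *)

Set Implicit Arguments.
Unset Strict Implicit.
Unset Printing Implicit Defensive.

Import Order.TTheory.
Local Open Scope fset_scope.
Local Open Scope classical_set_scope.

(** Each token of [w] lies in some [F x], and directedness, applied once per token, merges these
    finitely many indices into one. Continuity and compactness below both rest on this. *)
Lemma directed_fset_sub {d : Order.disp_t} (T : porderType d) (U : choiceType)
    (S : set T) (F : T -> set U) (w : {fset U}) :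
  directed S -> (forall x y, (x <= y)%O -> F x `<=` F y) ->
  [set` w] `<=` \bigcup_(x in S) F x -> exists2 x, S x & [set` w] `<=` F x.
Proof.
move=> [[x0 Sx0] Sdir] Fle; elim/finSet_rect: w => w IH wF.
have [->|[e ew]] := fset_0Vmem w; first by exists x0.
have [|x Sx xw] := IH (w `\ e)%fset (fproperD1 ew).
  by move=> i /=; rewrite !inE => /andP[_ iw]; exact: wF.
have [y Sy ye] := wF e ew.
have [z [Sz xz yz]] := Sdir x y Sx Sy.
exists z => // i /= iw.
have [->|ie] := eqVneq i e; first exact: Fle yz _ ye.
by apply: (Fle _ _ xz); apply: xw; rewrite /= !inE ie.
Qed.

(** * Ideals generated by finite sets *)

Section Entailment.
Variable A : algInfoSystem.
Implicit Types (u v w : {fset token A}) (x : set (token A)).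

Lemma entails_trans2 v u w : u ⊢[A] v -> v ⊢[A] w -> u ⊢[A] w.
Proof.
move=> uv vw; apply: (@entails_trans A u w [:: v]); last by rewrite big_seq1.
by move=> z; rewrite inE => /eqP ->.
Qed.

(** The singletons of [v] form a finite family with union [v], so the transitivity axiom applies. *)
Lemma entails1 u v : (forall d, d \in v -> u ⊢[A] [fset d]) -> u ⊢[A] v.
Proof.
move=> uv; apply: (@entails_trans A u v [seq [fset d] | d <- enum_fset v]).
  by move=> _ /mapP[d dv ->]; exact: uv.
rewrite big_map bigfcup_imfset1; apply: entails_sub.
by apply/fsubsetP => d dv; apply/imfsetP; exists d.
Qed.

Definition entails_closure u : set (token A) := [set d | u ⊢[A] [fset d]].

Lemma sub_entails_closure u v : [set` v] `<=` entails_closure u <-> u ⊢[A] v.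
Proof.
split=> [uv|uv d /= dv]; first exact/entails1.
by apply: entails_trans2 uv _; apply: entails_sub; rewrite fsub1set.
Qed.

Lemma entails_closure_ideal u :
  ~ u ⊢[A] [fset nabla A] -> is_ideal (entails_closure u).
Proof.
move=> uN; split=> // v w /sub_entails_closure uv vw.
by apply/sub_entails_closure; exact: entails_trans2 uv vw.
Qed.

Lemma entails_closure_sub x u :
  is_ideal x -> [set` u] `<=` x -> entails_closure u `<=` x.
Proof. by move=> [_ xC] ux d ud; apply: (xC _ _ ux ud); rewrite /= inE. Qed.

Lemma ideal_consistent x u :
  is_ideal x -> [set` u] `<=` x -> ~ u ⊢[A] [fset nabla A].
Proof. by move=> xI ux uN; case: (xI) => + _; apply; apply: entails_closure_sub ux _ uN. Qed.

Lemma ideal_bigcup {d : Order.disp_t} (T : porderType d) (S : set T)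
    (F : T -> set (token A)) :
  directed S -> (forall i j, (i <= j)%O -> F i `<=` F j) ->
  (forall i, S i -> is_ideal (F i)) -> is_ideal (\bigcup_(i in S) F i).
Proof.
move=> Sdir Fle FI; split; first by move=> [i /FI[]].
move=> u v /(directed_fset_sub Sdir Fle)[i Si ui] uv.
by apply: subset_trans (bigcup_sup Si); case: (FI i Si) => _; apply; eauto.
Qed.

End Entailment.

(** * Images of ideals under [|p|] *)

Section ApproximableMapping.
Variables (A : algInfoSystem) (p : approxMap A).
Implicit Types (u v w : {fset token A}) (x y : set (token A)).

Lemma approx_entails u v w : u ⊢[A] v -> p v w -> p u w.
Proof. by move=> uv pvw; exact: approx_mono uv pvw (entails_refl _). Qed.

Lemma sub_approx_image x v :
  [set` v] `<=` approx_image p x <-> exists2 u, [set` u] `<=` x & p u v.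
Proof.
split=> [/approx_image_fset//|[u ux puv] d /= dv]; exists u => //.
by apply: approx_mono (entails_refl _) puv _; apply: entails_sub; rewrite fsub1set.
Qed.

(** A finite [w] inside [cl u] with [w p v] can be replaced by [u], since [u] entails [w]. For
    [u = v], the relation [v p v] thus means that [v] lies in [|p|(cl v)]. *)
Lemma approx_image_closure u v :
  [set` v] `<=` approx_image p (entails_closure u) <-> p u v.
Proof.
split=> [/sub_approx_image[w /sub_entails_closure uw]|puv].
  exact: approx_entails.
by apply/sub_approx_image; exists u => //; apply/sub_entails_closure/entails_refl.
Qed.

Lemma approx_image_mono x y :
  x `<=` y -> approx_image p x `<=` approx_image p y.
Proof. by move=> xy d [u ux pu]; exists u => //; exact: subset_trans xy. Qed.

(** Scott continuity of [|p|]: a token of the image depends on a finite set, which lies in one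
    member of the family. *)
Lemma approx_image_bigcup {d : Order.disp_t} (T : porderType d) (S : set T)
    (F : T -> set (token A)) :
  directed S -> (forall i j, (i <= j)%O -> F i `<=` F j) ->
  approx_image p (\bigcup_(i in S) F i) = \bigcup_(i in S) approx_image p (F i).
Proof.
move=> Sdir Fle; rewrite eqEsubset; split=> [e [u]|].
  by move=> /(directed_fset_sub Sdir Fle)[i Si ui] pu; exists i => //; exists u.
by apply: bigcup_sub => i Si; apply: approx_image_mono; exact: bigcup_sup.
Qed.

(** * Fixed points and their directed suprema *)

Let FP : porderType _ := fixed_points (@approx_fun A p).

(** A fixed point is wrapped in two subtypes, that of fixed points and that of ideals; both are
    removed here. *)
Definition fp_tokens (X : FP) : set (token A) := \val (\val X : domain A).

Lemma fp_ideal (X : FP) : is_ideal (fp_tokens X).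
Proof. exact: set_mem (valP (\val X : domain A)). Qed.

Lemma fp_image (X : FP) : approx_image p (fp_tokens X) = fp_tokens X.
Proof. exact: (congr1 \val (set_mem (valP X))). Qed.

Lemma fp_ex x : is_ideal x -> approx_image p x = x ->
  exists X : FP, fp_tokens X = x.
Proof.
move=> xI px; pose y : domain A := SigSub (mem_set xI).
have py : approx_fun p y = y by exact: val_inj.
by exists (SigSub (mem_set (py : [set z | approx_fun p z = z] y))).
Qed.

Lemma fp_le (X Y : FP) : (X <= Y)%O <-> fp_tokens X `<=` fp_tokens Y.
Proof. by rewrite -!Order.le_val subsetEset. Qed.

Lemma fp_ubound (S : set FP) (s : FP) :
  ubound S s <-> \bigcup_(X in S) fp_tokens X `<=` fp_tokens s.
Proof.
split=> [sS|Ss X SX]; first by apply: bigcup_sub => X /sS /fp_le.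
by apply/fp_le; apply: subset_trans Ss; exact: bigcup_sup.
Qed.

Lemma fp_isLub (S : set FP) (s : FP) :
  fp_tokens s = \bigcup_(X in S) fp_tokens X -> isLub S s.
Proof.
move=> sE; split=> [|b /fp_ubound Sb]; first by apply/fp_ubound; rewrite sE.
by apply/fp_le; rewrite sE.
Qed.

Lemma fp_directed_lub (S : set FP) : directed S ->
  exists s : FP, fp_tokens s = \bigcup_(X in S) fp_tokens X.
Proof.
move=> Sdir; have Fle (X Y : FP) : (X <= Y)%O -> fp_tokens X `<=` fp_tokens Y.
  by move/fp_le.
apply: fp_ex; first by apply: ideal_bigcup => // X _; exact: fp_ideal.
by rewrite approx_image_bigcup //; apply: eq_bigcupr => X _; exact: fp_image.
Qed.

(** The union is itself a fixed point and an upper bound, so the least upper bound lies below it. *)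
Lemma fp_lub_tokens (S : set FP) (s : FP) : directed S -> isLub S s ->
  fp_tokens s = \bigcup_(X in S) fp_tokens X.
Proof.
move=> Sdir [sS sleast]; have [t tE] := fp_directed_lub Sdir.
rewrite eqEsubset; split; last exact/fp_ubound.
by rewrite -tE; apply/fp_le/sleast; apply/fp_ubound; rewrite tE.
Qed.

Lemma fp_fset_sub_lub (S : set FP) (s : FP) w : directed S -> isLub S s ->
  [set` w] `<=` fp_tokens s -> exists2 X, S X & [set` w] `<=` fp_tokens X.
Proof.
move=> Sdir Ss; rewrite (fp_lub_tokens Sdir Ss); apply: directed_fset_sub => //.
by move=> X Y /fp_le.
Qed.

(** If [K] is below a directed supremum, the finite set [v] already lies in one member, which then
    contains all of [cl v]. *)
Lemma fp_closure_compact (K : FP) v :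
  fp_tokens K = entails_closure v -> compact_element K.
Proof.
move=> KE S s Sdir Ss /fp_le Ks.
have [|X SX vX] := @fp_fset_sub_lub S s v Sdir Ss.
  by apply: subset_trans Ks; rewrite KE; apply/sub_entails_closure/entails_refl.
exists X => //; apply/fp_le; rewrite KE.
by apply: entails_closure_sub vX; exact: fp_ideal.
Qed.

(** * From algebraicity to interpolants *)

Section Projection.
Hypothesis proj : projection (@approx_fun A p).

Lemma projection_sub x : is_ideal x -> approx_image p x `<=` x.
Proof.
move=> xI; case: proj => _ /(_ (SigSub (mem_set xI) : domain A)).
by rewrite -Order.le_val subsetEset.
Qed.

Lemma projection_idem x : is_ideal x ->
  approx_image p (approx_image p x) = approx_image p x.
Proof.
move=> xI; case: proj => /(congr1 (fun f => f (SigSub (mem_set xI)))) + _.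
by move=> /(congr1 \val).
Qed.

Lemma compact_fp_generator (K : FP) : compact_element K ->
  exists v, [/\ [set` v] `<=` fp_tokens K, p v v &
    fp_tokens K = approx_image p (entails_closure v)].
Proof.
(* Compactness of [K] is tested on this family: it is directed through unions of generators, and its
   supremum is [K] because [|p|(K) = K]. *)
move=> Kc; pose S : set FP := [set X | exists2 u : {fset token A}, [set` u] `<=` fp_tokens K &
  fp_tokens X = approx_image p (entails_closure u)].
have clI u : [set` u] `<=` fp_tokens K -> is_ideal (entails_closure u).
  by move=> uK; apply: entails_closure_ideal; apply: ideal_consistent (fp_ideal K) uK.
have Sex u : [set` u] `<=` fp_tokens K -> exists2 X, S X &
    fp_tokens X = approx_image p (entails_closure u).
  move=> uK; have [X XE] := fp_ex (approx_image_ideal p (clI u uK))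
    (projection_idem (clI u uK)).
  by exists X => //; exists u.
have mono u v : v ⊢[A] u -> approx_image p (entails_closure u) `<=`
    approx_image p (entails_closure v).
  by move=> vu; apply: approx_image_mono => d; exact: entails_trans2.
have SK X : S X -> fp_tokens X `<=` fp_tokens K.
  move=> [u uK ->]; rewrite -[X in _ `<=` X]fp_image.
  by apply: approx_image_mono; apply: entails_closure_sub uK; exact: fp_ideal.
have Sdir : directed S.
  split; first by have [|X SX _] := Sex fset0; [move=> ? | exists X].
  move=> X Y [u uK XE] [v vK YE]; have [|Z SZ ZE] := Sex (u `|` v)%fset.
    by rewrite set_fsetU; move=> d [/uK|/vK].
  exists Z; split=> //; apply/fp_le; rewrite (XE, YE) ZE; apply: mono.
    exact/entails_sub/fsubsetUl.
  exact/entails_sub/fsubsetUr.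
have Klub : isLub S K.
  apply: fp_isLub; rewrite eqEsubset; split; last exact: bigcup_sub.
  rewrite -{1}fp_image => d [u uK pud]; have [X SX XE] := Sex u uK.
  exists X => //; rewrite XE; exists u => //.
  exact/sub_entails_closure/entails_refl.
have [X SX /fp_le KX] := Kc S K Sdir Klub (lexx K).
have [v vK XE] := SX.
have KE : fp_tokens K = approx_image p (entails_closure v).
  by rewrite -XE eqEsubset; split=> //; exact: SK.
(* [v] lies in [K = |p|(cl v)], which amounts to [v p v]. *)
by exists v; split=> //; apply/approx_image_closure; rewrite -KE.
Qed.

End Projection.

Lemma finitary_projection_interpolation : finitary_projection (@approx_fun A p) ->
  forall u w, p u w -> exists v, [/\ u ⊢[A] v, p v v & v ⊢[A] w].
Proof.
move=> [proj [_ alg]] u w puw.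
have [uN|uN] := pselect (u ⊢[A] [fset nabla A]).
  (* For inconsistent [u] there is no ideal [cl u], but [nabla] interpolates. *)
  by exists [fset nabla A]%fset; split=> //; [exact: approx_nabla|exact: entails_nabla].
have clI := entails_closure_ideal uN.
have [Y YE] := fp_ex (approx_image_ideal p clI) (projection_idem proj clI).
have [cdir club] := alg Y.
(* [Y] is [|p|(cl u)], so it contains [w]; one compact [K] below [Y] does too, and its generator is
   the interpolant. *)
have [|K [Kc /fp_le KY] wK] := @fp_fset_sub_lub _ Y w cdir club.
  by rewrite YE; apply/approx_image_closure.
have [v [vK pvv KE]] := compact_fp_generator proj Kc.
have vI : is_ideal (entails_closure v).
  by apply: entails_closure_ideal; exact: ideal_consistent (fp_ideal K) vK.
exists v; split=> //; apply/sub_entails_closure.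
  apply: subset_trans vK _; apply: subset_trans KY _; rewrite YE.
  exact: projection_sub.
by apply: subset_trans wK _; rewrite KE; exact: projection_sub.
Qed.

(** * From interpolants to algebraicity *)

Section Interpolation.
Hypothesis interp : forall u w, p u w ->
  exists v, [/\ u ⊢[A] v, p v v & v ⊢[A] w].

Lemma interpolation_projection : projection (@approx_fun A p).
Proof.
have sub x : is_ideal x -> approx_image p x `<=` x.
  move=> xI d [u ux /interp[v [uv _ vd]]].
  by apply: (entails_closure_sub xI ux); exact: entails_trans2 uv vd.
split; last first.
  by move=> x; rewrite -Order.le_val subsetEset; exact: sub (set_mem (valP x)).
apply/funext => x; apply: val_inj; have xI : is_ideal (\val x) := set_mem (valP x).
rewrite /= eqEsubset; split; first exact: sub (approx_image_ideal p xI).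
(* The interpolant separates two applications of [|p|]: [u p v] puts [v] into [|p|(x)], and
   [v p {d}] then gives [d] in the second image. *)
move=> d [u ux /interp[v [uv pvv vd]]]; exists v.
  by apply/sub_approx_image; exists u => //; exact: approx_entails uv pvv.
exact: approx_mono (entails_refl _) pvv vd.
Qed.

(** [v p v] gives one inclusion between [cl v] and its image, the projection property the other;
    lying in [X] makes [v] consistent. *)
Lemma fp_closure_ex v (X : FP) : p v v -> [set` v] `<=` fp_tokens X ->
  exists2 K, compact_element K & fp_tokens K = entails_closure v.
Proof.
move=> pvv vX; have vI : is_ideal (entails_closure v).
  by apply: entails_closure_ideal; exact: ideal_consistent (fp_ideal X) vX.
have [|K KE] := fp_ex vI; last by exists K => //; exact: fp_closure_compact KE.
rewrite eqEsubset; split.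
  exact: projection_sub interpolation_projection _ vI.
apply: entails_closure_sub; first exact: approx_image_ideal.
exact/approx_image_closure.
Qed.

(** As [X] is fixed, [u p w] for some finite [u] inside [X]; the interpolant is entailed by [u], so
    it stays in [X]. *)
Lemma fp_interpolation (X : FP) w : [set` w] `<=` fp_tokens X ->
  exists v, [/\ [set` v] `<=` fp_tokens X, p v v & v ⊢[A] w].
Proof.
rewrite -{1}fp_image => /sub_approx_image[u uX /interp[v [uv pvv vw]]].
by exists v; split=> //; case: (fp_ideal X) => _; apply; eauto.
Qed.

Lemma compact_fp_below (K X : FP) : compact_element K -> (K <= X)%O ->
  exists v, [/\ [set` v] `<=` fp_tokens X, p v v &
    fp_tokens K `<=` entails_closure v].
Proof.
move=> /(compact_fp_generator interpolation_projection)[v [vK pvv KE]] /fp_le KX.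
exists v; split=> //; first exact: subset_trans vK KX.
rewrite KE; apply: (projection_sub interpolation_projection).
by apply: entails_closure_ideal; exact: ideal_consistent (fp_ideal K) vK.
Qed.

Lemma interpolation_algebraic : algebraic FP.
Proof.
split=> [S /fp_directed_lub[s sE]|X]; first by exists s; exact: fp_isLub.
have below v : p v v -> [set` v] `<=` fp_tokens X -> exists2 K,
    compacts_below X K & fp_tokens K = entails_closure v.
  move=> pvv vX; have [K Kc KE] := fp_closure_ex pvv vX.
  exists K => //; split=> //; apply/fp_le; rewrite KE.
  by apply: entails_closure_sub vX; exact: fp_ideal.
split; [split|].
- have [|K KX _] := below fset0 (approx0 p); first by move=> ?.
  by exists K.
- move=> K L [Kc KX] [Lc LX].
  have [u [uX puu Ku]] := compact_fp_below Kc KX.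
  have [v [vX pvv Lv]] := compact_fp_below Lc LX.
  (* The upper bound of [K] and [L] is [cl (u ∪ v)], compact because [u ∪ v] is again related to
     itself by [p]. *)
  have [||M MX ME] := below (u `|` v)%fset.
  + apply: approx_union.
      exact: approx_entails (entails_sub (fsubsetUl _ _)) puu.
    exact: approx_entails (entails_sub (fsubsetUr _ _)) pvv.
  + by rewrite set_fsetU; move=> d [/uX|/vX].
  exists M; split=> //; apply/fp_le; rewrite ME.
    apply: subset_trans Ku _ => d; apply: entails_trans2.
    exact/entails_sub/fsubsetUl.
  apply: subset_trans Lv _ => d; apply: entails_trans2.
  exact/entails_sub/fsubsetUr.
- apply: fp_isLub; rewrite eqEsubset; split; last first.
    by apply: bigcup_sub => K [_ /fp_le].
  move=> d dX; have [|v [vX pvv vd]] := @fp_interpolation X [fset d]%fset.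
    by move=> e /=; rewrite inE => /eqP ->.
  by have [K KX KE] := below v pvv vX; exists K => //; rewrite KE.
Qed.

End Interpolation.

End ApproximableMapping.

Theorem lemma8p1p4 (A : algInfoSystem) (p : approxMap A) :
  finitary_projection (@approx_fun A p) <->
  (forall u w : {fset token A}, p u w ->
     exists v : {fset token A}, [/\ u ⊢[A] v, p v v & v ⊢[A] w]).
Proof.
split; first exact: finitary_projection_interpolation.
move=> interp; split; first exact: interpolation_projection.
exact: interpolation_algebraic.
Qed.
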